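(* There are constants $c$ and $n_0$ such that for all $n\ge n_0$, all integers $h\ge0$ and every surface $S$ of Euler genus $h$, the number of $n$-vertex simple maps in $S$ is at most $c^{n+h}h^h$.
   Context: A map is a connected pseudograph (loops and multiple edges allowed) cellularly embedded in a surface, considered as an unlabelled, unrooted object (up to isomorphism of embedded graphs). A map is simple if its underlying pseudograph is a simple graph, and $n$-vertex if it has $n$ vertices. Convention $0^0=1$. *)

(* Defs.v *)
From mathcomp Require Import all_boot all_fingroup.
Set Implicit Arguments.
Unset Strict Implicit.
Unset Printing Implicit Defensive.

Local Open Scope group_scope.

(* A map with m edges is encoded on the set of 4m flags 'I_(4*m) by three
   permutations (a0, a1, a2): fixed-point-free involutions with a0 a2 = a2 a0
   a fixed-point-free involution, and a transitive monodromy group.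
   vertices = orbits of <a1,a2>, edges = orbits of <a0,a2>,
   faces = orbits of <a0,a1>. *)
Section Maps.
Variable m : nat.
Local Notation F := 'I_(4 * m).

Definition triple := ({perm F} * {perm F} * {perm F})%type.
Definition al0 (t : triple) : {perm F} := t.1.1.
Definition al1 (t : triple) : {perm F} := t.1.2.
Definition al2 (t : triple) : {perm F} := t.2.

Definition fpf_involution (p : {perm F}) : bool :=
  (p * p == 1) && [forall x, p x != x].

Definition is_map (t : triple) : bool :=
  [&& fpf_involution (al0 t), fpf_involution (al1 t), fpf_involution (al2 t),
      al0 t * al2 t == al2 t * al0 t,
      [forall x, al0 t (al2 t x) != x] &
      [transitive <<[set al0 t; al1 t; al2 t]>>, on [set: F] | 'P]].

Definition vertex_of (t : triple) (x : F) : {set F} :=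
  orbit 'P <<[set al1 t; al2 t]>> x.
Definition edge_of (t : triple) (x : F) : {set F} :=
  orbit 'P <<[set al0 t; al2 t]>> x.
Definition face_of (t : triple) (x : F) : {set F} :=
  orbit 'P <<[set al0 t; al1 t]>> x.

Definition nverts (t : triple) : nat := #|[set vertex_of t x | x : F]|.
Definition nedges (t : triple) : nat := #|[set edge_of t x | x : F]|.
Definition nfaces (t : triple) : nat := #|[set face_of t x | x : F]|.

(* Euler genus h: V - E + F = 2 - h, written without subtraction. *)
Definition has_euler_genus (t : triple) (h : nat) : bool :=
  nverts t + nfaces t + h == 2 + nedges t.

(* For a connected map: orientable iff the even-word subgroup
   <a0 a1, a1 a2> has exactly two orbits on flags. *)
Definition orientable (t : triple) : bool :=
  #|[set orbit 'P <<[set al0 t * al1 t; al1 t * al2 t]>> x | x : F]| == 2.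

Definition simple_map (t : triple) : bool :=
  [forall x, vertex_of t x != vertex_of t (al0 t x)] &&
  [forall x, forall y,
     ([set vertex_of t x; vertex_of t (al0 t x)] ==
      [set vertex_of t y; vertex_of t (al0 t y)]) ==> (edge_of t x == edge_of t y)].

Definition map_iso (t u : triple) : bool :=
  [exists s : {perm F}, u == (al0 t ^ s, al1 t ^ s, al2 t ^ s)].

Definition simple_maps_in (n h : nat) (o : bool) : {set triple} :=
  [set t | [&& is_map t, simple_map t, nverts t == n,
              has_euler_genus t h & orientable t == o]].

Definition iso_classes (n h : nat) (o : bool) : {set {set triple}} :=
  [set [set u | map_iso t u] | t in simple_maps_in n h o].

End Maps.

(* A (closed) surface is determined by its Euler genus h and orientability:
   orientable surfaces have even Euler genus, non-orientable ones h >= 1. *)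
Definition surface_exists (h : nat) (o : bool) : bool :=
  if o then ~~ odd h else 0 < h.

(* Number of unlabelled n-vertex simple maps in the surface (h, o).  A simple
   graph on n vertices has at most 'C(n,2) edges, so summing over edge counts
   m <= 'C(n,2) counts all of them. *)
Definition num_simple_maps (n h : nat) (o : bool) : nat :=
  \sum_(m < 'C(n, 2).+1) #|iso_classes m n h o|.

(* Main.v *)
(** A map with [m] edges on a surface of Euler genus [h] is cut along a spanning tree [T]
    and a spanning tree [U] of the dual that avoids [T]; by Euler's formula [h] edges lie
    outside [T] and [U].  Walking around [T] is a single cycle through all flags, and
    relabelling the flags makes this cycle a fixed one.  The two sides of every edge of
    [T] are joined by chords of the cycle that do not cross, so the chords are determined
    by the set of flags at which they open.  The walk around [U] in the dual is again a
    single cycle; it crosses only the edges outside [U], so once these are known its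
    non-crossing chords give the edges of [U].  The [h] remaining edges have at most
    [(4h)^h] positions.  Hence there are at most [2^(20m) (4h)^h] maps with [m] edges, and
    [m] is linear in [n + h] because the faces of a simple map have degree at least 3. *)

Require Import Defs.
From mathcomp Require Import all_boot all_fingroup.
From mathcomp Require Import zify.
Set Implicit Arguments.
Unset Strict Implicit.
Unset Printing Implicit Defensive.

(** * Counting *)

Lemma leq_card_imset_encoding (X Y C : finType) (f : X -> Y) (D : {set X})
    (E : {set C}) (encodes : X -> C -> Prop) :
  {in D, forall x, exists2 c, c \in E & encodes x c} ->
  {in D &, forall x y c, encodes x c -> encodes y c -> f x = f y} ->
  #|f @: D| <= #|E|.
Proof.
move=> encodable decodable.
have /fin_all_exists[g gP] (z : {y | y \in f @: D}) :
    exists c, c \in E /\ exists2 x, x \in D & f x = val z /\ encodes x c.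
  case: z => y yfD; have /imsetP[x xD xy] := yfD.
  by have [c cE xc] := encodable x xD; exists c; split=> //; exists x.
have g_inj : injective g.
  move=> z1 z2 g12; apply: val_inj.
  have [_ [x1 x1D [<- e1]]] := gP z1; have [_ [x2 x2D [<- e2]]] := gP z2.
  by rewrite -g12 in e2; apply: (decodable x1 x2 x1D x2D _ e1 e2).
rewrite -[leqLHS]card_sig -cardsT -(card_imset _ g_inj).
by apply/subset_leq_card/subsetP => _ /imsetP[z _ ->]; have [] := gP z.
Qed.

Lemma leq_card_fibers (A B : finType) (D : {set A * B}) K :
  (forall a, #|[set b | (a, b) \in D]| <= K) -> #|D| <= #|A| * K.
Proof.
move=> fibersK; rewrite -sum1_card (partition_big fst predT) //= -sum_nat_const.
apply: leq_sum => a _; apply: leq_trans (fibersK a).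
rewrite sum1dep_card -(card_in_imset (f := snd)).
  apply/subset_leq_card/subsetP => _ /imsetP[[a' b] + ->].
  by rewrite !inE => /andP[abD /eqP<-].
by move=> [a1 b1] [a2 b2]; rewrite !inE /= => /andP[_ /eqP->] /andP[_ /eqP->] ->.
Qed.

Lemma leq_sum_truncated (f : nat -> nat) M L K :
  (forall m, f m <= (m <= L) * K) -> \sum_(m < M) f m <= L.+1 * K.
Proof.
move=> fK; apply: leq_trans (_ : minn M L.+1 * K <= _).
  elim: M => [|M IHM]; first by rewrite big_ord0.
  rewrite big_ord_recr /=; apply: leq_trans (leq_add IHM (fK M)) _.
  by rewrite -mulnDl leq_mul2r; apply/orP; right; lia.
by rewrite leq_mul2r geq_minr orbT.
Qed.

(** * Connected components *)

Lemma homo_connect (F G : finType) (e : rel F) (e' : rel G) (f : F -> G) :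
  {homo f : x y / e x y >-> e' x y} ->
  {homo f : x y / connect e x y >-> connect e' x y}.
Proof.
move=> fe x y /connectP[s es ->]; apply/connectP.
by exists (map f s); [apply: homo_path es | rewrite last_map].
Qed.

Section Connect.
Variables (F : finType) (e : rel F).

Lemma connect_ind (P : pred F) x y :
  (forall u v, e u v -> P u -> P v) -> connect e x y -> P x -> P y.
Proof.
move=> eP /connectP[s es ->] {y}.
by elim: s x es => //= y s IHs x /andP[/eP xy /IHs sP] /xy /sP.
Qed.

Lemma connect_invariant (T : eqType) (f : F -> T) x y :
  (forall u v, e u v -> f u = f v) -> connect e x y -> f x = f y.
Proof.
move=> ef exy; apply/eqP; rewrite eq_sym.
by apply: (connect_ind (P := fun z => f z == f x)) exy _ => // u v /ef->.
Qed.

Lemma mono_connect (e' : rel F) (s : {perm F}) :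
  {mono s : x y / e x y >-> e' x y} ->
  {mono s : x y / connect e x y >-> connect e' x y}.
Proof.
move=> es x y; apply/idP/idP; last by apply: homo_connect => u v; rewrite es.
rewrite -{2}[x](permK s) -{2}[y](permK s); apply: homo_connect => u v.
by rewrite -es !permKV.
Qed.

End Connect.

Section Components.
Variables (F : finType) (e : rel F).
Hypothesis e_sym : connect_sym e.

Lemma card_components : #|[set [set y | connect e x y] | x : F]| = n_comp e F.
Proof.
have componentP x y : [set z | connect e x z] = [set z | connect e y z] ->
    root e x = root e y.
  by move=> /setP/(_ y); rewrite !inE connect0 => /(rootP e_sym).
rewrite -[RHS](card_in_imset (f := fun x => [set y | connect e x y])); last first.
  move=> x y; rewrite !inE => /andP[/eqP rx _] /andP[/eqP ry _] /componentP.
  by rewrite rx ry.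
apply: eq_card => C; apply/imsetP/imsetP => -[x _ ->]; last by exists x.
exists (root e x); first by rewrite !inE roots_root.
by apply/setP => z; rewrite !inE (same_connect e_sym (connect_root e x)).
Qed.

Lemma n_comp_le1 : (forall x y, connect e x y) -> n_comp e F <= 1.
Proof.
move=> conn; apply/card_le1_eqP => x y; rewrite !inE => /andP[/eqP<- _] /andP[/eqP<- _].
exact/(rootP e_sym).
Qed.

Lemma n_comp_merge (e' : rel F) u v : connect_sym e' ->
  (forall x y, e' x y -> connect e x y || [&& connect e u x || connect e v x
                                           & connect e u y || connect e v y]) ->
  n_comp e F <= (n_comp e' F).+1.
Proof.
move=> e'_sym merge.
pose merged x := connect e u x || connect e v x.
pose f x := if merged x then root e u else root e x.
have f_inv x y : e' x y -> f x = f y.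
  move=> /merge /orP[exy|/andP[mx my]]; last by rewrite /f /merged mx my.
  by rewrite /f /merged -!(same_connect_r e_sym exy) (rootP e_sym exy).
have f_root x : root e x = x -> x != root e v -> f x = x.
  rewrite /f; case: ifP => // /orP[] /(rootP e_sym) eq_root rx; first by rewrite eq_root.
  by rewrite eq_root rx eqxx.
pose R := [predI roots e & F].
rewrite /n_comp_mem -/R (cardD1 (root e v)) -addn1 addnC leq_add ?leq_b1 //.
have root_inj : {in [predD1 R & root e v] &, injective (root e')}.
  move=> x y; rewrite !inE => /and3P[xv /eqP rx _] /and3P[yv /eqP ry _].
  by move=> /(rootP e'_sym) /(connect_invariant f_inv); rewrite !f_root.
rewrite -(card_in_imset root_inj); apply/subset_leq_card/subsetP => z.
by case/imsetP=> x _ ->; rewrite !inE roots_root.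
Qed.

End Components.

(** * Alternating walks *)

Definition free_involution (T : eqType) (f : T -> T) :=
  involutive f /\ forall x, f x != x.

Fixpoint walk (T : Type) (p b : T -> T) (x0 : T) k :=
  if k is k'.+1 then (if odd k' then b else p) (walk p b x0 k') else x0.

Definition alt_step (F : eqType) (p b : F -> F) : rel F :=
  [rel x y | (y == p x) || (y == b x)].

Definition tour (F : finType) (p b : F -> F) (x0 : F) := mkseq (walk p b x0) #|F|.

Lemma eq_walk (T : Type) (p b p' b' : T -> T) x0 :
  p =1 p' -> b =1 b' -> walk p b x0 =1 walk p' b' x0.
Proof. by move=> eq_p eq_b; elim=> //= k ->; case: ifP. Qed.

Lemma eq_tour (F : finType) (p b p' b' : F -> F) x0 :
  p =1 p' -> b =1 b' -> tour p b x0 = tour p' b' x0.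
Proof. by move=> eq_p eq_b; apply: eq_map; apply: eq_walk. Qed.

Lemma map_tour (F : finType) (p b p' b' s : F -> F) x0 :
  {morph s : x / p x >-> p' x} -> {morph s : x / b x >-> b' x} ->
  map s (tour p b x0) = tour p' b' (s x0).
Proof.
move=> sp sb; rewrite /tour /mkseq -map_comp; apply: eq_map.
by elim=> //= k <-; case: ifP.
Qed.

Lemma head_tour (F : finType) (p b : F -> F) x0 : head x0 (tour p b x0) = x0.
Proof. by rewrite /tour; case: #|F|. Qed.

Section Walk.
Variables (F : finType) (p b : F -> F) (x0 : F).
Hypotheses (p_inv : free_involution p) (b_inv : free_involution b).

Let pK : involutive p := p_inv.1.
Let bK : involutive b := b_inv.1.
Notation w := (walk p b x0).

Lemma walk_p k : p (w k) = w (if odd k then k.-1 else k.+1).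
Proof. by case: k => [|k] //=; case odd_k: (odd k); rewrite /= ?odd_k ?pK. Qed.

Lemma walk_b k : 0 < k -> b (w k) = w (if odd k then k.+1 else k.-1).
Proof. by case: k => [|k] //= _; case odd_k: (odd k); rewrite /= ?odd_k ?bK. Qed.

(* If [w i = w j] with [i] and [j] of different parity, then [w i.+1 = w j.-1], so
   that the two indices can be moved towards each other until they are adjacent. *)
Lemma walk_parity i j : i < j -> w i = w j -> odd i = odd j.
Proof.
elim: {j}(j - i).+1 {-2}i {-2}j (ltnSn (j - i)) => // d IHd {}i {}j dij ij wij.
apply/eqP/negPn/negP => odd_ne; case: j => // j in dij ij wij odd_ne *.
have {}odd_ne : odd i = odd j by move: odd_ne => /=; case: (odd i); case: (odd j).
have wSi : w i.+1 = w j.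
  by rewrite /= wij /= -odd_ne; case: ifP => _; rewrite ?pK ?bK.
have [eij|ne_ij] := eqVneq i j.
  move: wSi => /=; rewrite eij; case: ifP => _ /eqP.
    by rewrite (negPf (b_inv.2 _)).
  by rewrite (negPf (p_inv.2 _)).
have [eij|ne_Sij] := eqVneq i.+1 j.
  by move: odd_ne; rewrite -eij /=; case: (odd i).
have /= : odd i.+1 = odd j by apply: IHd wSi; lia.
by rewrite odd_ne; case: (odd j).
Qed.

Lemma walk_return i d : 0 < d -> w i = w (i + d) -> w d = x0.
Proof.
move=> d_gt0; elim: i => [<-//|i IHi] wi; apply: IHi.
have /(walk_parity (i := i.+1))/(_ wi) /negb_inj odd_i : i.+1 < i.+1 + d by lia.
move: wi; rewrite addSn /= -[odd (i + d)]odd_i.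
by case: ifP => _; [move/(can_inj bK) | move/(can_inj pK)].
Qed.

Lemma walk_period : exists K, [/\ 0 < K <= #|F|, ~~ odd K, w K = x0 &
  {in gtn K &, injective w}].
Proof.
have closed_walk i j : i < j -> w i = w j -> w (j - i) = x0.
  by move=> ij wij; apply: (@walk_return i); rewrite ?subnKC // ?subn_gt0 // ltnW.
have exK : exists K, (0 < K <= #|F|) && (w K == x0).
  have /injectivePn[i [j ne_ij wij]] : ~~ injectiveb (fun i : 'I_#|F|.+1 => w i).
    by apply/negP => /injectiveP /leq_card; rewrite card_ord ltnn.
  wlog ij : i j ne_ij wij / i < j.
    move=> wlog_ij; have := ne_ij; rewrite neq_ltn => /orP[]; first exact: wlog_ij.
    by apply: wlog_ij => //; rewrite eq_sym.
  exists (j - i); rewrite closed_walk // eqxx; have := ltn_ord j; lia.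
case: (ex_minnP exK) => K /andP[K_bounds /eqP wK] Kmin.
have walk_neq i j : i < j -> j < K -> w i <> w j.
  by move=> ij jK /(closed_walk _ _ ij)/eqP wij; have := Kmin (j - i); rewrite wij; lia.
exists K; split=> //; first by rewrite -(@walk_parity 0 K) //; lia.
move=> i j iK jK wij; case: (ltngtP i j) => // /walk_neq; first by case/(_ jK).
by case/(_ iK).
Qed.

Lemma walkD K k : ~~ odd K -> w K = x0 -> w (K + k) = w k.
Proof.
move=> oddK wK; elim: k => [|k IHk]; first by rewrite addn0.
by rewrite addnS /= IHk oddD (negPf oddK).
Qed.

Lemma walk_modn K k : ~~ odd K -> w K = x0 -> w (k %% K) = w k.
Proof.
move=> oddK wK; rewrite [in RHS](divn_eq k K).
by elim: (k %/ K) => // q IHq; rewrite mulSn -addnA walkD.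
Qed.

Lemma walk_pred K : 0 < K -> ~~ odd K -> w K = x0 -> b x0 = w K.-1.
Proof. by move=> K_gt0 oddK wK; rewrite -{1}wK walk_b // (negPf oddK). Qed.

Lemma connect_alt_p x : connect (alt_step p b) x (p x).
Proof. by apply: connect1; rewrite /alt_step /= eqxx. Qed.

Lemma connect_alt_b x : connect (alt_step p b) x (b x).
Proof. by apply: connect1; rewrite /alt_step /= eqxx orbT. Qed.

Lemma connect_alt_sym : connect_sym (alt_step p b).
Proof.
apply: sym_connect_sym => x y; rewrite /alt_step /=.
by rewrite !(eq_sym y) (inv_eq pK) (inv_eq bK) !(eq_sym x).
Qed.

Lemma connect_walk k : connect (alt_step p b) x0 (w k).
Proof.
elim: k => //= k IHk; apply: connect_trans IHk _.
by case: ifP => _; [apply: connect_alt_b | apply: connect_alt_p].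
Qed.

(* The walk from [x0] is a cycle through [b x0], and it takes the step between [x0] and
   [b x0] last. *)
Lemma connect_alt_bypass (b' : F -> F) :
  (forall x, connect (alt_step p b) x0 x -> x != x0 -> x != b x0 -> b' x = b x) ->
  connect (alt_step p b') x0 (b x0).
Proof.
move=> eq_b; have [K [/andP[K_gt0 _] oddK wK w_inj]] := walk_period.
have bx0 := walk_pred K_gt0 oddK wK.
suff prefix k : k < K -> connect (alt_step p b') x0 (w k).
  by rewrite bx0 prefix // prednK.
elim: k => // k IHk kK; apply: connect_trans (IHk (ltnW kK)) _.
rewrite [w k.+1]/=; case: ifP => odd_k; apply: connect1; rewrite /alt_step /= ?eqxx //.
rewrite eq_b ?eqxx ?orbT //; first exact: connect_walk.
  by apply/eqP => /(w_inj k 0 (ltnW kK) K_gt0) k0; rewrite k0 in odd_k.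
apply/eqP; rewrite bx0 => /(w_inj k K.-1 (ltnW kK)); rewrite inE prednK //.
by move=> /(_ (leqnn _)) eq_k; rewrite eq_k prednK ?ltnn in kK.
Qed.

Hypothesis conn : forall x, connect (alt_step p b) x0 x.

Lemma walk_hamiltonian : [/\ ~~ odd #|F|, w #|F| = x0, uniq (tour p b x0) &
  forall x, x \in tour p b x0].
Proof.
have [K [/andP[K_gt0 _] oddK wK w_inj]] := walk_period.
have mem_walk k : w k \in mkseq w K.
  by rewrite -(walk_modn k oddK wK); apply/map_f; rewrite mem_iota ltn_mod.
have onto x : x \in mkseq w K.
  apply: (connect_ind (P := mem (mkseq w K))) (conn x) (mem_walk 0) => u y.
  move=> + /mapP[k _ eu]; rewrite eu -(walkD k oddK wK) => /orP[] /eqP-> /=.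
    by rewrite walk_p.
  by rewrite walk_b // addn_gt0 K_gt0.
have uniqK : uniq (mkseq w K).
  by rewrite map_inj_in_uniq ?iota_uniq // => i j; rewrite !mem_iota; apply: w_inj.
have eK : K = #|F| by rewrite -(eq_card onto) (card_uniqP uniqK) size_mkseq.
by rewrite /tour -eK.
Qed.

Lemma mem_tour x : x \in tour p b x0.
Proof. by case: walk_hamiltonian. Qed.

Lemma tour_uniq : uniq (tour p b x0).
Proof. by case: walk_hamiltonian. Qed.

Lemma index_tour_lt x : index x (tour p b x0) < #|F|.
Proof. by rewrite -[ltnRHS](size_mkseq w) index_mem mem_tour. Qed.

Lemma walk_index x : w (index x (tour p b x0)) = x.
Proof. by rewrite -[RHS](nth_index x0 (mem_tour x)) nth_mkseq // index_tour_lt. Qed.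

Lemma index_walk k : k < #|F| -> index (w k) (tour p b x0) = k.
Proof.
by move=> kF; rewrite -(nth_mkseq x0 w kF) index_uniq ?tour_uniq // size_mkseq.
Qed.

End Walk.

Lemma tour_inj (F : finType) (p b p' b' : F -> F) x0 :
  free_involution p -> free_involution b ->
  (forall x, connect (alt_step p b) x0 x) ->
  free_involution p' -> free_involution b' ->
  (forall x, connect (alt_step p' b') x0 x) ->
  tour p b x0 = tour p' b' x0 -> p =1 p' /\ b =1 b'.
Proof.
move=> p_inv b_inv conn p'_inv b'_inv conn' eq_tours.
have [oddF wF _ _] := walk_hamiltonian p_inv b_inv conn.
have [_ wF' _ _] := walk_hamiltonian p'_inv b'_inv conn'.
have F_gt0 : 0 < #|F| by apply/card_gt0P; exists x0.
have eq_w : walk p b x0 =1 walk p' b' x0.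
  move=> k; rewrite -(walk_modn _ oddF wF) -[RHS](walk_modn _ oddF wF').
  have kF : k %% #|F| < #|F| by rewrite ltn_mod.
  by rewrite -(nth_mkseq x0 (walk p b x0) kF) -/(tour _ _ _) eq_tours nth_mkseq.
split=> x; rewrite -(walk_index p_inv b_inv conn x).
  by rewrite (walk_p _ _ p_inv) !eq_w (walk_p _ _ p'_inv).
have k_gt0 k : 0 < #|F| + k by rewrite addn_gt0 F_gt0.
by rewrite -(walkD _ oddF wF) (walk_b _ _ b_inv) ?eq_w ?(walk_b _ _ b'_inv).
Qed.

(** * Subgraphs of a flag system *)

Section FlagSystem.
Variable F : finType.
Implicit Types (p q r : F -> F) (A B : {set F}).

(* A map is used as a flag system with [(p, q, r) = (a1, a2, a0)], and its dual with
   [(p, q, r) = (a1, a0, a2)]: [p] and [q] turn around a vertex, and [r] runs along an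
   edge. *)
Record flag_system p q r : Prop := FlagSystem {
  flag_p : free_involution p;
  flag_q : free_involution q;
  flag_r : free_involution r;
  flag_comm : forall x, q (r x) = r (q x);
  flag_qr_neq : forall x, q (r x) != x }.

Definition edge q r u : {set F} := [set u; q u; r u; q (r u)].

Definition edge_closed q r A := [forall x in A, (q x \in A) && (r x \in A)].

Definition subgraph_step p q r A : rel F :=
  [rel x y | [|| y == p x, y == q x | (x \in A) && (y == r x)]].

Definition acyclic p q r A :=
  forall u, u \in A -> ~~ connect (subgraph_step p q r (A :\: edge q r u)) u (r u).

Definition spanning_tree p q r A :=
  [/\ edge_closed q r A, acyclic p q r A &
      forall x y, connect (subgraph_step p q r A) x y].

(* Alternating [p] with [contour_step q r A] follows the boundary of a thickening of
   the subgraph [A]. *)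
Definition contour_step q r A x := if x \in A then r x else q x.

Definition contour p q r A x0 := tour p (contour_step q r A) x0.

Lemma flag_system_dual p q r : flag_system p q r -> flag_system p r q.
Proof. by case=> p_inv q_inv r_inv qr qr_neq; split=> // x; rewrite -qr. Qed.

Lemma edge_closed_dual q r A : edge_closed q r A -> edge_closed r q A.
Proof. by move=> /forallP closedA; apply/forallP => x; rewrite andbC. Qed.

Variables p q r : F -> F.
Hypothesis fs : flag_system p q r.

Let pK : involutive p := (flag_p fs).1.
Let qK : involutive q := (flag_q fs).1.
Let rK : involutive r := (flag_r fs).1.
Let qr := flag_comm fs.
Let q_inj := can_inj qK.
Notation joined A := (connect (subgraph_step p q r A)).

Lemma edge_closedP A :
  reflect (forall x, ((q x \in A) = (x \in A)) /\ ((r x \in A) = (x \in A)))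
          (edge_closed q r A).
Proof.
apply: (iffP forallP) => [closedA x | closedA x]; last first.
  by have [-> ->] := closedA x; rewrite andbb; apply/implyP.
have {}closedA y : y \in A -> (q y \in A) /\ (r y \in A).
  by move=> yA; apply/andP; move: (closedA y); rewrite yA.
by split; apply/idP/idP => /closedA[]; rewrite ?qK ?rK.
Qed.

Lemma edge_closed_edge u : edge_closed q r (edge q r u).
Proof.
apply/forallP => x; apply/implyP; rewrite !inE -!orbA.
by case/or4P=> /eqP->; rewrite ?rK ?qK -?qr ?rK ?qK ?eqxx ?orbT // qr rK eqxx ?orbT.
Qed.

Lemma edge_closedT : edge_closed q r [set: F].
Proof. by apply/forallP => x; rewrite !inE. Qed.

Lemma edge_closedD A B :
  edge_closed q r A -> edge_closed q r B -> edge_closed q r (A :\: B).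
Proof.
move=> /edge_closedP closedA /edge_closedP closedB; apply/edge_closedP => x.
by have [qA rA] := closedA x; have [qB rB] := closedB x; rewrite !inE qA rA qB rB.
Qed.

Lemma edge_id u : u \in edge q r u.
Proof. by rewrite !inE eqxx. Qed.

Lemma edge_sub A u : edge_closed q r A -> u \in A -> edge q r u \subset A.
Proof.
move=> /edge_closedP closedA uA; apply/subsetP => x; rewrite !inE -!orbA.
have [qA rA] := closedA u; have [qrA _] := closedA (r u).
by case/or4P=> /eqP->; rewrite ?qrA ?qA ?rA.
Qed.

Lemma card_edge u : #|edge q r u| = 4.
Proof.
have q_neq := (flag_q fs).2; have r_neq := (flag_r fs).2; have qr_neq := flag_qr_neq fs.
have qr_distinct : q u != r u by rewrite -(inj_eq q_inj) qK eq_sym qr_neq.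
have -> : edge q r u = u |: (q u |: (r u |: [set q (r u)])).
  by apply/setP => x; rewrite !inE -!orbA.
rewrite !cardsU1 cards1 !inE !negb_or (inj_eq q_inj) qr_distinct.
by rewrite !(eq_sym u) [r u == q _]eq_sym !q_neq r_neq qr_neq.
Qed.

Lemma edge_eq u v : v \in edge q r u -> edge q r v = edge q r u.
Proof.
move=> vu; apply/eqP; rewrite eqEcard !card_edge leqnn andbT.
exact: edge_sub (edge_closed_edge u) vu.
Qed.

Lemma edge_partition A :
  edge_closed q r A -> partition [set edge q r u | u in A] A.
Proof.
move=> closedA; have equiv : {in A & &, equivalence_rel (fun u v => v \in edge q r u)}.
  move=> u v x _ _ _; rewrite edge_id; split=> // vu.
  by rewrite (edge_eq vu).
rewrite (_ : [set _ | _ in A] = equivalence_partition (fun u v => v \in edge q r u) A).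
  exact: equivalence_partitionP.
apply: eq_in_imset => u uA; apply/setP => v; rewrite inE andbC.
by case vu: (v \in _) => //; rewrite (subsetP (edge_sub closedA uA)).
Qed.

Lemma edge_representatives A : edge_closed q r A ->
  exists R : {set F}, [/\ R \subset A, #|A| = #|R| * 4 &
    A \subset \bigcup_(u in R) edge q r u].
Proof.
move=> closedA; have partA := edge_partition closedA.
pose R := transversal [set edge q r u | u in A] A.
have trR : is_transversal R [set edge q r u | u in A] A := transversalP partA.
have RA := transversal_sub trR; exists R; split=> //.
  rewrite (card_transversal trR) (card_uniform_partition (n := 4) _ partA) //.
  by move=> _ /imsetP[u _ ->]; apply: card_edge.
apply/subsetP => x xA; have trivE := partition_trivIset partA.
have /imsetP[u uR xu] : edge q r x \in pblock [set edge q r u | u in A] @: R.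
  by rewrite (pblock_transversal trR) imset_f.
apply/bigcupP; exists u => //; have uA := subsetP RA u uR.
by rewrite -(def_pblock trivE (imset_f _ uA) (edge_id u)) -xu edge_id.
Qed.

Lemma edge_closed_ind (P : {set F} -> Prop) : P set0 ->
  (forall A u, edge_closed q r A -> u \in A -> P (A :\: edge q r u) -> P A) ->
  forall A, edge_closed q r A -> P A.
Proof.
move=> P0 PE A; elim: {A}_.+1 {-2}A (ltnSn #|A|) => // n IHn A An closedA.
have [->//|/set0Pn[u uA]] := eqVneq A set0.
apply: (PE A u) => //; apply: IHn; last by rewrite edge_closedD ?edge_closed_edge.
rewrite -ltnS (leq_trans _ An) // ltnS proper_card // properE subsetDl.
by apply/subsetPn; exists u; rewrite // inE edge_id.
Qed.

Lemma contour_step_inv A :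
  edge_closed q r A -> free_involution (contour_step q r A).
Proof.
move=> /edge_closedP closedA; rewrite /contour_step; split=> x.
  by case xA: (x \in A); have [qA rA] := closedA x; rewrite ?qA ?rA xA.
by case: ifP => _; [apply: (flag_r fs).2 | apply: (flag_q fs).2].
Qed.

Lemma joined_sym A : edge_closed q r A -> connect_sym (subgraph_step p q r A).
Proof.
move=> /edge_closedP closedA; apply: sym_connect_sym => x y; rewrite /subgraph_step /=.
rewrite !(eq_sym y) (inv_eq pK) (inv_eq qK) (inv_eq rK) !(eq_sym x).
congr [|| _, _ | _]; apply: andb_id2r => /eqP yx.
by have [_ rA] := closedA y; rewrite -yx rA.
Qed.

Lemma joined_p A x : joined A x (p x).
Proof. by apply: connect1; rewrite /subgraph_step /= eqxx. Qed.

Lemma joined_q A x : joined A x (q x).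
Proof. by apply: connect1; rewrite /subgraph_step /= eqxx orbT. Qed.

Lemma joined_r A x : x \in A -> joined A x (r x).
Proof. by move=> xA; apply: connect1; rewrite /subgraph_step /= xA eqxx !orbT. Qed.

Lemma sub_joined A (e : rel F) :
  (forall x, connect e x (p x)) -> (forall x, connect e x (q x)) ->
  {in A, forall x, connect e x (r x)} -> subrel (joined A) (connect e).
Proof.
by move=> ep eq er; apply: connect_sub => x y /or3P[||/andP[xA]] /eqP->; auto.
Qed.

Lemma joined_subset A B : A \subset B -> subrel (joined A) (joined B).
Proof.
move=> /subsetP AB; apply: sub_joined => [x|x|x /AB xB].
- exact: joined_p.
- exact: joined_q.
- exact: joined_r.
Qed.

Lemma joined_contour A :
  subrel (connect (alt_step p (contour_step q r A))) (joined A).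
Proof.
apply: connect_sub => x y /orP[] /eqP->; first exact: joined_p.
by rewrite /contour_step; case: ifP => xA; [apply: joined_r | apply: joined_q].
Qed.

Lemma joined_edge A u x :
  x \in edge q r u -> joined A u x || joined A (r u) x.
Proof.
by rewrite !inE -!orbA => /or4P[] /eqP->; rewrite ?connect0 ?joined_q ?orbT.
Qed.

Lemma edge_r u x : x \in edge q r u -> r x \in edge q r u.
Proof. by have /edge_closedP/(_ x)[_ ->] := edge_closed_edge u. Qed.

Lemma acyclic_subset A B : B \subset A -> acyclic p q r A -> acyclic p q r B.
Proof.
move=> BA acyclicA u uB; apply: contra (acyclicA u (subsetP BA u uB)).
exact/joined_subset/setSD.
Qed.

Lemma leq_components_subgraph A : edge_closed q r A ->
  4 * n_comp (subgraph_step p q r set0) F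
    <= 4 * n_comp (subgraph_step p q r A) F + #|A|.
Proof.
elim/edge_closed_ind: {A}_ / => [|A u closedA uA IHA]; first by rewrite cards0 addn0.
have cardA : #|A| = 4 + #|A :\: edge q r u|.
  by rewrite -(cardsID (edge q r u) A) (setIidPr (edge_sub closedA uA)) card_edge.
suff : n_comp (subgraph_step p q r (A :\: edge q r u)) F
        <= (n_comp (subgraph_step p q r A) F).+1 by lia.
apply: (n_comp_merge _ (u := u) (v := r u)).
- by apply: joined_sym; rewrite edge_closedD ?edge_closed_edge.
- exact: joined_sym.
move=> x y /or3P[||/andP[xA]] /eqP->; rewrite ?joined_p ?joined_q //.
have [xu|xu] := boolP (x \in edge q r u); last by rewrite joined_r // inE xu.
by rewrite !joined_edge ?orbT // edge_r.
Qed.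

Lemma connect_contour_bridge A u : edge_closed q r A ->
  connect (alt_step p (contour_step q r (A :\: edge q r u))) =2
    joined (A :\: edge q r u) ->
  ~~ joined (A :\: edge q r u) u (r u) ->
  connect (alt_step p (contour_step q r A)) u (q u).
Proof.
set B := A :\: edge q r u => closedA contourB not_joined.
have closedB : edge_closed q r B by rewrite edge_closedD ?edge_closed_edge.
have stepBu : contour_step q r B u = q u by rewrite /contour_step inE edge_id.
rewrite -stepBu; apply: connect_alt_bypass.
- exact: flag_p fs.
- exact: contour_step_inv.
move=> x; rewrite contourB stepBu /contour_step => joined_ux x_u x_qu.
suff -> : x \in B = (x \in A) by [].
rewrite inE -[RHS]andTb; congr (_ && _).
rewrite !inE !negb_or x_u x_qu /=; apply/andP; split; apply: contra not_joined.
  by move/eqP<-.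
by move=> /eqP ex; apply: connect_trans joined_ux _; rewrite ex -{2}(qK (r u)) joined_q.
Qed.

(* Around a bridge the contours of the two sides merge into one cycle. *)
Lemma connect_contour A : edge_closed q r A -> acyclic p q r A ->
  connect (alt_step p (contour_step q r A)) =2 joined A.
Proof.
elim/edge_closed_ind: {A}_ / => [_ x y|A u closedA uA IHA acyclicA x y].
  apply/idP/idP; first exact: joined_contour.
  apply: sub_joined x y => [x|x|x]; last by rewrite inE.
    exact: connect_alt_p.
  by have := connect_alt_b p (contour_step q r set0) x; rewrite {2}/contour_step inE.
set B := A :\: edge q r u in IHA.
have {}IHA := IHA (acyclic_subset (subsetDl _ _) acyclicA).
have contour_q v :
    v \in edge q r u -> connect (alt_step p (contour_step q r A)) v (q v).
  move=> vu; apply: connect_contour_bridge => //; rewrite (edge_eq vu) //.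
  by rewrite -(edge_eq vu) acyclicA // (subsetP (edge_sub closedA uA)).
have contourB : subrel (joined B) (connect (alt_step p (contour_step q r A))).
  move=> v v'; rewrite -IHA; apply: connect_sub v v' => v v' /orP[] /eqP->.
    exact: connect_alt_p.
  have [vu|vu] := boolP (v \in edge q r u).
    by rewrite {2}/contour_step inE vu contour_q.
  have -> : contour_step q r B v = contour_step q r A v.
    by rewrite /contour_step inE vu.
  exact: connect_alt_b.
apply/idP/idP; first exact: joined_contour.
apply: sub_joined x y => [x|x|x xA]; first exact: connect_alt_p.
  exact/contourB/joined_q.
by have := connect_alt_b p (contour_step q r A) x; rewrite {2}/contour_step xA.
Qed.

Lemma minimal_connected_acyclic A : edge_closed q r A ->
  (forall x y, joined A x y) ->
  (forall B, edge_closed q r B -> (forall x y, joined B x y) -> B \subset A -> B = A) ->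
  acyclic p q r A.
Proof.
move=> closedA connA minA u uA; apply/negP => joined_u.
have closedB : edge_closed q r (A :\: edge q r u).
  by rewrite edge_closedD ?edge_closed_edge.
have from_u x : x \in edge q r u -> joined (A :\: edge q r u) u x.
  by move=> /(joined_edge (A :\: edge q r u))/orP[//|]; apply: connect_trans.
suff /minA/(_ (subsetDl _ _)) : forall x y, joined (A :\: edge q r u) x y.
  by move=> /(_ closedB)/setP/(_ u); rewrite inE edge_id uA.
move=> x y; apply: sub_joined (connA x y) => {x y} [x|x|x xA].
- exact: joined_p.
- exact: joined_q.
- have [xu|xu] := boolP (x \in edge q r u); last by rewrite joined_r // inE xu.
  rewrite (connect_trans _ (from_u _ (edge_r xu))) // (joined_sym closedB).
  exact: from_u.
Qed.

Lemma spanning_tree_exists D : edge_closed q r D -> (forall x y, joined D x y) ->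
  exists2 A : {set F}, A \subset D & spanning_tree p q r A.
Proof.
move=> closedD connD.
pose connecting A := edge_closed q r A && [forall x, forall y, joined A x y].
have connectingP A :
    reflect (edge_closed q r A /\ forall x y, joined A x y) (connecting A).
  apply: (iffP andP) => -[closedA conn]; split=> //.
    by move=> x y; move: conn => /forallP/(_ x)/forallP.
  by apply/forallP => x; apply/forallP.
have connectingD : connecting D by apply/connectingP.
have [A /minsetP[/connectingP[closedA connA] minA] AD] := minset_exists connectingD.
exists A => //; split=> //; apply: minimal_connected_acyclic => // B closedB connB.
by apply: minA; apply/connectingP.
Qed.

Lemma leq_components_spanning_tree A : spanning_tree p q r A ->
  4 * n_comp (subgraph_step p q r set0) F <= 4 + #|A|.
Proof.
case=> closedA _ connA; apply: leq_trans (leq_components_subgraph closedA) _.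
by rewrite leq_add2r -[leqRHS]muln1 leq_mul2l n_comp_le1 //; apply: joined_sym.
Qed.

End FlagSystem.

(** * Non-crossing matchings *)

Section Matching.
Variables (T : eqType) (A : {pred T}) (pos : T -> nat).
Implicit Types q : T -> T.

Definition noncrossing_matching q :=
  [/\ free_involution q, {in A, forall x, q x \in A} &
      {in A &, forall u y, pos u < pos y < pos (q u) -> pos u < pos (q y) < pos (q u)}].

Definition opener q x := pos x < pos (q x).

Hypothesis pos_inj : injective pos.

Lemma opener_match q x : free_involution q -> opener q (q x) = ~~ opener q x.
Proof.
move=> [qK q_neq]; rewrite /opener qK -leqNgt ltn_neqAle.
by rewrite (inj_eq pos_inj) q_neq.
Qed.

(* If [q u] comes before [q' u], then the [q']-partner [z] of [q u] comes after [u], and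
   the [q]-chord at [z] lies inside the one at [u]: hence [q z] comes before [q' z], and
   the chord from [z] to [q' z] is strictly inside the one from [u] to [q' u]. *)
Lemma leq_match_opener q q' : noncrossing_matching q -> noncrossing_matching q' ->
  {in A, opener q =1 opener q'} ->
  {in A, forall u, opener q u -> pos (q' u) <= pos (q u)}.
Proof.
move=> [q_inv qA q_nc] [q'_inv q'A q'_nc] eq_opener u uA.
elim: {u}(pos (q' u)).+1 {-2}u (ltnSn (pos (q' u))) uA => // n IHn u un uA u_open.
rewrite leqNgt; apply/negP => qu_lt.
have quA := qA u uA; pose z := q' (q u).
have q'z : q' z = q u := q'_inv.1 (q u).
have zA : z \in A by rewrite q'A.
have z_open : opener q' z.
  by rewrite opener_match // -eq_opener // opener_match // u_open.
have z_lt_qu : pos z < pos (q u) by rewrite -q'z.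
have /andP[u_lt_z _] : pos u < pos z < pos (q' u)
  by apply: q'_nc => //; apply/andP.
have /andP[_ qz_lt] : pos u < pos (q z) < pos (q u)
  by apply: q_nc => //; apply/andP.
suff : pos (q' z) <= pos (q z) by rewrite q'z leqNgt qz_lt.
by apply: IHn; rewrite ?q'z ?(leq_trans qu_lt) ?eq_opener.
Qed.

Lemma noncrossing_matching_unique q q' :
  noncrossing_matching q -> noncrossing_matching q' ->
  {in A, opener q =1 opener q'} -> {in A, q =1 q'}.
Proof.
move=> q_match q'_match eq_opener.
have [q_inv qA _] := q_match; have [q'_inv _ _] := q'_match.
have eq_at_opener u : u \in A -> opener q u -> q u = q' u.
  move=> uA u_open; apply/pos_inj/anti_leq/andP; split.
    by apply: (leq_match_opener q'_match q_match); rewrite -?eq_opener // => x /eq_opener.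
  exact: (leq_match_opener q_match q'_match).
move=> u uA; have [/(eq_at_opener u uA)//|u_close] := boolP (opener q u).
have := eq_at_opener (q u) (qA u uA); rewrite opener_match // q_inv.1.
by move=> /(_ u_close) eu; rewrite {2}eu q'_inv.1.
Qed.

End Matching.

Definition contour_index (F : finType) (p q r : F -> F) (A : {set F}) x0 x :=
  index x (contour p q r A x0).

Section TreeContour.
Variables (F : finType) (p q r : F -> F) (A : {set F}) (x0 : F).
Hypotheses (fs : flag_system p q r) (treeA : spanning_tree p q r A).

Let p_inv : free_involution p := flag_p fs.
Let closedA : edge_closed q r A. Proof. by case: treeA. Qed.
Let step_inv : free_involution (contour_step q r A) := contour_step_inv fs closedA.
Let qK : involutive q := (flag_q fs).1.
Let rK : involutive r := (flag_r fs).1.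
Notation w := (walk p (contour_step q r A) x0).
Notation pos := (contour_index p q r A x0).

Lemma contour_connected x y : connect (alt_step p (contour_step q r A)) x y.
Proof. by have [_ acyclicA connA] := treeA; rewrite connect_contour. Qed.

Let conn := contour_connected x0.

Lemma contour_uniq : uniq (contour p q r A x0).
Proof. exact: tour_uniq. Qed.

Lemma mem_contour x : x \in contour p q r A x0.
Proof. exact: mem_tour. Qed.

Lemma walk_contour_index x : w (pos x) = x.
Proof. exact: walk_index. Qed.

Lemma contour_index_lt x : pos x < #|F|.
Proof. exact: index_tour_lt. Qed.

Lemma contour_index_inj : injective pos.
Proof. exact: can_inj walk_contour_index. Qed.

Lemma walk_neq k x : k < #|F| -> k != pos x -> w k != x.
Proof. by move=> kF; apply: contra => /eqP<-; rewrite /contour_index index_walk. Qed.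

Definition near_side u : pred F :=
  connect (subgraph_step p q r (A :\: edge q r u)) u.

Lemma near_side_invariant u x y :
  subgraph_step p q r (A :\: edge q r u) x y -> near_side u x = near_side u y.
Proof.
move=> /connect1 xy; rewrite /near_side (same_connect_r _ xy) //.
apply: joined_sym fs _ _.
exact: (edge_closedD fs closedA (edge_closed_edge fs u)).
Qed.

Lemma near_side_p u x : near_side u (p x) = near_side u x.
Proof. by apply/esym/near_side_invariant; rewrite /subgraph_step /= eqxx. Qed.

Lemma near_side_q u x : near_side u (q x) = near_side u x.
Proof. by apply/esym/near_side_invariant; rewrite /subgraph_step /= eqxx orbT. Qed.

Lemma near_side_contour_step u x : x \notin [set u; q u] ->
  contour_step q r A x \notin [set u; q u] ->
  near_side u (contour_step q r A x) = near_side u x.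
Proof.
rewrite /contour_step; case: ifP => [xA|_ _ _]; last exact: near_side_q.
rewrite !inE !negb_or => /andP[x_u x_qu] /andP[rx_u rx_qu].
apply/esym/near_side_invariant; rewrite /subgraph_step /= !inE xA !negb_or x_u x_qu /=.
rewrite eqxx !andbT (flag_comm fs) -!(inv_eq rK) rx_u.
by rewrite eq_sym -(inv_eq rK) eq_sym rx_qu !orbT.
Qed.

Lemma near_side_walk u i d :
  (forall k, i <= k <= i + d -> w k \notin [set u; q u]) ->
  near_side u (w (i + d)) = near_side u (w i).
Proof.
elim: d => [|d IHd] avoid; first by rewrite addn0.
rewrite addnS [w _.+1]/= -IHd; last by move=> k k_in; apply: avoid; lia.
case: ifP => odd_k; last exact: near_side_p.
apply: near_side_contour_step; first by apply: avoid; lia.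
by have := avoid (i + d).+1; rewrite /= odd_k; apply; lia.
Qed.

Lemma near_side_crossing u :
  u \in A -> near_side u (contour_step q r A u) = false.
Proof.
by move=> uA; rewrite /contour_step uA; case: treeA => _ /(_ u uA)/negbTE.
Qed.

Lemma near_side_after u : u \in A -> near_side u (w (pos u).+1) = ~~ odd (pos u).
Proof.
move=> uA; rewrite [w _.+1]/= walk_contour_index //; case: ifP => _.
  exact: near_side_crossing.
by rewrite near_side_p; apply: connect0.
Qed.

Lemma near_side_before u : u \in A -> near_side u (w (#|F| + pos u).-1) = odd (pos u).
Proof.
move=> uA; have [oddF wF _ _] := walk_hamiltonian p_inv step_inv conn.
have pos_gt0 : 0 < #|F| + pos u by apply/ltn_addr/card_gt0P; exists u.
have odd_pos : odd (#|F| + pos u) = odd (pos u) by rewrite oddD (negPf oddF).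
have wu : w (#|F| + pos u) = u by rewrite walkD // walk_contour_index.
have := walk_p (contour_step q r A) x0 p_inv (#|F| + pos u).
have := walk_b p x0 step_inv pos_gt0; rewrite wu odd_pos.
case: ifP => [_ _ <-|_ <- _]; last exact: near_side_crossing.
by rewrite near_side_p; apply: connect0.
Qed.

Lemma near_side_inside u y : u \in A -> pos u < pos y < pos (q u) ->
  near_side u y = ~~ odd (pos u).
Proof.
move=> uA y_in; rewrite -(near_side_after uA) -{1}(walk_contour_index y).
rewrite -(subnKC (_ : (pos u).+1 <= pos y)); last by case/andP: y_in.
apply: near_side_walk => k k_in; have qu_lt := contour_index_lt (q u).
by rewrite !inE negb_or !walk_neq //; lia.
Qed.

Lemma near_side_outside u y : u \in A -> pos u < pos (q u) ->
  (pos y < pos u) || (pos (q u) < pos y) -> near_side u y = odd (pos u).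
Proof.
move=> uA u_lt y_out; have [oddF wF _ _] := walk_hamiltonian p_inv step_inv conn.
have [k k_in <-] : exists2 k, pos (q u) < k < #|F| + pos u & w k = y.
  have [y_u|u_y] := ltnP (pos y) (pos u).
    exists (#|F| + pos y); last by rewrite walkD // walk_contour_index.
    by have := contour_index_lt (q u); lia.
  exists (pos y); last by rewrite walk_contour_index.
  by have := contour_index_lt y; lia.
rewrite -(near_side_before uA) -(subnKC (_ : k <= (#|F| + pos u).-1)); last by lia.
apply/esym/near_side_walk => l l_in; rewrite !inE negb_or.
have lt_qu := contour_index_lt (q u).
have [lF|Fl] := ltnP l #|F|; first by rewrite !walk_neq //; lia.
by rewrite -(subnKC Fl) !walkD // !walk_neq //; lia.
Qed.

(* The two arcs of the contour between [u] and [q u] are the two sides of the edge of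
   [u], and a chord has both ends on the same side. *)
Lemma noncrossing_contour : noncrossing_matching [in A] pos q.
Proof.
split=> [|x xA|u y uA yA y_in]; first exact: flag_q fs.
  by have /(edge_closedP fs)/(_ x)[->] := closedA.
have u_lt : pos u < pos (q u) by case/andP: y_in => /ltn_trans; apply.
have ne_u : pos (q y) != pos u.
  rewrite (inj_eq contour_index_inj) (inv_eq qK).
  by apply: contraTneq y_in => ->; rewrite ltnn andbF.
have ne_qu : pos (q y) != pos (q u).
  rewrite (inj_eq contour_index_inj) (inj_eq (can_inj qK)).
  by apply: contraTneq y_in => ->; rewrite ltnn.
apply: contraT => out; have := near_side_q u y.
rewrite (near_side_inside uA y_in) near_side_outside //; first by case: odd.
lia.
Qed.

End TreeContour.

Definition openers (F : finType) (p q r : F -> F) (A : {set F}) (x0 : F) :=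
  [set x in A | opener (contour_index p q r A x0) q x].

Lemma tree_openers_inj (F : finType) (p q r p' q' r' : F -> F) (A : {set F}) x0 :
  flag_system p q r -> spanning_tree p q r A ->
  flag_system p' q' r' -> spanning_tree p' q' r' A ->
  contour p q r A x0 = contour p' q' r' A x0 ->
  openers p q r A x0 = openers p' q' r' A x0 -> {in A, q =1 q'}.
Proof.
move=> fs treeA fs' treeA' eq_contour eq_openers.
have match_q := noncrossing_contour x0 fs treeA.
have match_q' := noncrossing_contour x0 fs' treeA'.
have eq_pos : contour_index p q r A x0 = contour_index p' q' r' A x0.
  by rewrite /contour_index eq_contour.
rewrite -eq_pos in match_q'.
apply: noncrossing_matching_unique match_q match_q' _; first exact: contour_index_inj.
by move=> x xA; move/setP/(_ x): eq_openers; rewrite !inE xA -eq_pos.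
Qed.

(** * Relabelling flags *)

Lemma exists_perm_map (F : finType) (s1 s2 : seq F) :
  uniq s1 -> (forall x, x \in s1) -> uniq s2 -> size s2 = size s1 ->
  exists s : {perm F}, map s s1 = s2.
Proof.
move=> uniq1 all1 uniq2 eq_size.
have index_lt x : index x s1 < size s2 by rewrite eq_size index_mem.
have nth_inj : injective (fun x => nth x s2 (index x s1)).
  move=> x y; rewrite (set_nth_default y) // => /eqP; rewrite nth_uniq // => /eqP.
  by move=> eq_index; rewrite -[x](nth_index y (all1 x)) eq_index nth_index.
exists (perm nth_inj); case: s1 => [|x0 s1'] in uniq1 all1 eq_size index_lt nth_inj *.
  by apply/esym/size0nil.
apply: (@eq_from_nth _ x0); first by rewrite size_map.
move=> i; rewrite size_map => i_lt; rewrite (nth_map x0) // permE index_uniq //.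
by apply: set_nth_default; rewrite eq_size.
Qed.

Section Relabel.
Variables (F : finType) (s p q r : {perm F}).
Implicit Types A : {set F}.
Local Open Scope group_scope.

Let mem_s A x : (s x \in s @: A) = (x \in A).
Proof. exact: mem_imset perm_inj. Qed.

Lemma free_involution_conj (a : {perm F}) :
  free_involution a -> free_involution (a ^ s).
Proof.
move=> [aK a_neq]; split=> x; rewrite -[x](permKV s) !permJ ?aK //.
by rewrite (inj_eq perm_inj).
Qed.

Lemma flag_system_conj : flag_system p q r -> flag_system (p ^ s) (q ^ s) (r ^ s).
Proof.
case=> p_inv q_inv r_inv qr qr_neq; split; try exact: free_involution_conj.
  by move=> x; rewrite -[x](permKV s) !permJ qr.
by move=> x; rewrite -[x](permKV s) !permJ (inj_eq perm_inj).
Qed.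

Lemma edge_conj u : edge (q ^ s) (r ^ s) (s u) = s @: edge q r u.
Proof. by rewrite /edge !imsetU !imset_set1 !permJ. Qed.

Lemma edge_closed_conj A :
  edge_closed q r A -> edge_closed (q ^ s) (r ^ s) (s @: A).
Proof.
move=> /forallP closedA; apply/forallP => x; rewrite -[x](permKV s) !permJ !mem_s.
exact: closedA.
Qed.

Lemma joined_conj A :
  {mono s : x y / connect (subgraph_step p q r A) x y >->
                  connect (subgraph_step (p ^ s) (q ^ s) (r ^ s) (s @: A)) x y}.
Proof.
apply: mono_connect => x y; rewrite /subgraph_step /= !permJ mem_s.
by rewrite !(inj_eq perm_inj).
Qed.

Lemma spanning_tree_conj A :
  spanning_tree p q r A -> spanning_tree (p ^ s) (q ^ s) (r ^ s) (s @: A).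
Proof.
move=> [closedA acyclicA connA]; split; first exact: edge_closed_conj.
  move=> u; rewrite -[u](permKV s) mem_s permJ edge_conj => uA.
  rewrite (_ : _ :\: _ = s @: (A :\: edge q r (s^-1 u))).
    by rewrite joined_conj acyclicA.
  by apply/setP => x; rewrite -[x](permKV s) in_setD !mem_s in_setD.
by move=> x y; rewrite -[x](permKV s) -[y](permKV s) joined_conj.
Qed.

Lemma contour_conj A x0 :
  contour (p ^ s) (q ^ s) (r ^ s) (s @: A) (s x0) = map s (contour p q r A x0).
Proof.
apply/esym/map_tour => x; first by rewrite permJ.
by rewrite /contour_step mem_s; case: ifP => _; rewrite permJ.
Qed.

End Relabel.

(** * Codes of maps *)

Section Skeleton.
Variable F : finType.
Implicit Types T U R : {set F}.

Definition tree_cotree (a0 a1 a2 : F -> F) T U :=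
  [/\ spanning_tree a1 a2 a0 T, spanning_tree a1 a0 a2 U & [disjoint T & U]].

Definition skeleton (a0 a1 a2 : F -> F) T U R :=
  tree_cotree a0 a1 a2 T U /\ ~: (T :|: U) \subset \bigcup_(u in R) edge a2 a0 u.

(* Euler's formula multiplied by four, as every edge has four flags. *)
Definition euler_genus_le (a0 a1 a2 : F -> F) h :=
  #|F| + 8 <= 4 * n_comp (subgraph_step a1 a2 a0 set0) F
              + 4 * n_comp (subgraph_step a1 a0 a2 set0) F + 4 * h.

Lemma tree_cotree_exists (a0 a1 a2 : F -> F) : flag_system a1 a2 a0 ->
  (forall x y, connect (subgraph_step a1 a2 a0 setT) x y) ->
  exists T U, tree_cotree a0 a1 a2 T U.
Proof.
move=> fs conn; have [T _ treeT] := spanning_tree_exists fs (edge_closedT a2 a0) conn.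
have [closedT _ _] := treeT.
have closedC : edge_closed a0 a2 (~: T).
  by apply: edge_closed_dual; rewrite -setTD (edge_closedD fs) ?edge_closedT.
have [|U subU treeU] := spanning_tree_exists (flag_system_dual fs) closedC; last first.
  by exists T, U; split; rewrite // disjoint_sym disjoints_subset.
move=> x y; apply: connect_sub (contour_connected fs treeT x y) => {}x {}y.
case/orP=> /eqP->; first exact: joined_p.
rewrite /contour_step; case: ifPn => xT; first exact: joined_q.
by apply: joined_r; rewrite inE.
Qed.

Lemma card_tree_cotree_outside (a0 a1 a2 : F -> F) T U h : flag_system a1 a2 a0 ->
  tree_cotree a0 a1 a2 T U -> euler_genus_le a0 a1 a2 h ->
  #|~: (T :|: U)| <= 4 * h.
Proof.
rewrite /euler_genus_le => fs [treeT treeU disjTU] genus_h.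
have := leq_components_spanning_tree fs treeT.
have := leq_components_spanning_tree (flag_system_dual fs) treeU.
have := cardsC (T :|: U); rewrite cardsU disjoint_setI0 // cards0; lia.
Qed.

Lemma edge_closed_outside (a0 a1 a2 : F -> F) T U : flag_system a1 a2 a0 ->
  tree_cotree a0 a1 a2 T U -> edge_closed a2 a0 (~: (T :|: U)).
Proof.
move=> fs [[closedT _ _] [/edge_closed_dual closedU _ _] _].
by rewrite setCU -setDE -setTD !(edge_closedD fs) ?edge_closedT.
Qed.

Lemma eq_on_edge (a0 a2 b0 b2 : F -> F) u x :
  involutive a0 -> (forall y, a2 (a0 y) = a0 (a2 y)) ->
  involutive b0 -> (forall y, b2 (b0 y) = b0 (b2 y)) ->
  a2 =1 b2 -> a0 u = b0 u -> x \in edge a2 a0 u -> a0 x = b0 x.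
Proof.
move=> a0K a20 b0K b20 eq2 eq0; rewrite !inE -!orbA => /or4P[] /eqP-> //.
- by rewrite -a20 eq0 !eq2 b20.
- by rewrite a0K eq0 b0K.
- by rewrite a20 a0K -a20 eq0 !eq2 b20 b0K.
Qed.

Lemma skeleton_inj (a0 a1 a2 b0 b1 b2 : F -> F) T U R x0 :
  flag_system a1 a2 a0 -> flag_system b1 b2 b0 ->
  skeleton a0 a1 a2 T U R -> skeleton b0 b1 b2 T U R ->
  contour a1 a2 a0 T x0 = contour b1 b2 b0 T x0 ->
  openers a1 a2 a0 T x0 = openers b1 b2 b0 T x0 ->
  openers a1 a0 a2 U x0 = openers b1 b0 b2 U x0 ->
  {in R, a0 =1 b0} -> [/\ a0 =1 b0, a1 =1 b1 & a2 =1 b2].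
Proof.
move=> fsa fsb [[treeT treeU _] coverR] [[treeT' treeU' _] _] eq_contour eqT eqU eqR.
have fsa' := flag_system_dual fsa; have fsb' := flag_system_dual fsb.
have [closedT _ _] := treeT; have [closedT' _ _] := treeT'.
have [eq1 eq_step] := tour_inj
  (flag_p fsa) (contour_step_inv fsa closedT) (contour_connected fsa treeT x0)
  (flag_p fsb) (contour_step_inv fsb closedT') (contour_connected fsb treeT' x0)
  eq_contour.
have eq2 : a2 =1 b2.
  move=> x; have [xT|xT] := boolP (x \in T).
    exact: (tree_openers_inj fsa treeT fsb treeT' eq_contour eqT).
  by have := eq_step x; rewrite /contour_step (negPf xT).
have eq0_notU x : x \notin U -> a0 x = b0 x.
  move=> xU; have [xT|xT] := boolP (x \in T).
    by have := eq_step x; rewrite /contour_step xT.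
  have /bigcupP[u uR] : x \in \bigcup_(u in R) edge a2 a0 u.
    by apply: (subsetP coverR); rewrite !inE negb_or xT.
  apply: eq_on_edge eq2 (eqR u uR).
  - exact: (flag_r fsa).1.
  - exact: flag_comm fsa.
  - exact: (flag_r fsb).1.
  - exact: flag_comm fsb.
split=> // x; have [xU|/eq0_notU//] := boolP (x \in U).
apply: (tree_openers_inj fsa' treeU fsb' treeU' _ eqU) xU.
apply: eq_tour eq1 _ => y; rewrite /contour_step; case: ifPn => [_|/eq0_notU//].
exact: eq2.
Qed.

End Skeleton.

Section Code.
Variables (F : finType) (x0 : F) (c : seq F) (h : nat).

Definition map_code : finType :=
  ({set F} * {set F} * {set F} * {set F} * {set F} * {ffun F -> F})%type.

Definition codes : {set map_code} :=
  [set k : map_code | let: (T, U, R, OT, OU, g) := k in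
    [&& #|R| <= h, #|~: (T :|: U)| <= 4 * h & g \in pffun_on x0 R (~: (T :|: U))]].

Definition encodes (a0 a1 a2 : F -> F) (k : map_code) :=
  let: (T, U, R, OT, OU, g) := k in
  [/\ skeleton a0 a1 a2 T U R, contour a1 a2 a0 T x0 = c,
      openers a1 a2 a0 T x0 = OT, openers a1 a0 a2 U x0 = OU & {in R, a0 =1 g}].

Lemma card_codes : #|codes| <= 2 ^ (5 * #|F|) * (4 * h) ^ h.
Proof.
have card_set : #|{: {set F}}| = 2 ^ #|F|.
  by rewrite -[LHS]cardsT -powersetT card_powerset cardsT.
have -> : 2 ^ (5 * #|F|) = #|{: {set F} * {set F} * {set F} * {set F} * {set F}}|.
  by rewrite !card_prod card_set -!expnD; congr (2 ^ _); lia.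
apply: leq_card_fibers => -[[[[T U] R] OT] OU].
have [small|large] := boolP ((#|R| <= h) && (#|~: (T :|: U)| <= 4 * h)); last first.
  rewrite (_ : [set _ | _] = set0) ?cards0 //; apply/setP => g; rewrite !inE.
  by rewrite andbA (negPf large).
have /andP[Rh outside_h] := small.
apply: leq_trans (_ : #|~: (T :|: U)| ^ #|R| <= _).
  rewrite -(card_pffun_on x0); apply/subset_leq_card/subsetP => g.
  by rewrite !inE => /and3P[].
have [->|R_gt0] := posnP #|R|; first by rewrite expn0 expn_gt0; case: (h).
have h_gt0 := leq_trans R_gt0 Rh.
by apply: leq_trans (leq_pexp2l _ Rh); rewrite ?leq_exp2r ?muln_gt0.
Qed.

Lemma encodes_inj (a0 a1 a2 b0 b1 b2 : F -> F) k :
  flag_system a1 a2 a0 -> flag_system b1 b2 b0 ->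
  encodes a0 a1 a2 k -> encodes b0 b1 b2 k -> [/\ a0 =1 b0, a1 =1 b1 & a2 =1 b2].
Proof.
case: k => [[[[[T U] R] OT] OU] g] fsa fsb.
move=> [skelA contA OTA OUA gA] [skelB contB OTB OUB gB].
apply: (skeleton_inj fsa fsb skelA skelB (x0 := x0)); rewrite ?contA ?OTA ?OUA //.
by move=> u uR; rewrite gA ?gB.
Qed.

Lemma tree_cotree_along (a0 a1 a2 : {perm F}) : flag_system a1 a2 a0 ->
  (forall x y, connect (subgraph_step a1 a2 a0 setT) x y) ->
  euler_genus_le a0 a1 a2 h -> uniq c -> size c = #|F| -> head x0 c = x0 ->
  exists (s : {perm F}) (T U : {set F}),
    [/\ tree_cotree (a0 ^ s)%g (a1 ^ s)%g (a2 ^ s)%g T U,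
        contour (a1 ^ s)%g (a2 ^ s)%g (a0 ^ s)%g T x0 = c &
        #|~: (T :|: U)| <= 4 * h].
Proof.
move=> fs conn genus_h uniq_c size_c head_c.
have [T [U tcTU]] := tree_cotree_exists fs conn; have [treeT treeU disjTU] := tcTU.
have [s contour_s] : exists s : {perm F}, map s (contour a1 a2 a0 T x0) = c.
  apply: exists_perm_map; rewrite ?size_c ?size_mkseq //.
    exact: contour_uniq fs treeT.
  exact: mem_contour fs treeT.
have sx0 : s x0 = x0.
  rewrite -[RHS]head_c -contour_s -nth0 (nth_map x0) ?nth0 ?head_tour // size_mkseq.
  by apply/card_gt0P; exists x0.
exists s, (s @: T), (s @: U); split.
- split; try exact: spanning_tree_conj.
  by rewrite imset_disjoint //; apply: perm_inj.
- by rewrite -{1}sx0 contour_conj.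
apply: leq_trans (card_tree_cotree_outside fs tcTU genus_h).
rewrite -imsetU cardsCs setCK card_imset; last exact: perm_inj.
by rewrite [leqRHS]cardsCs setCK.
Qed.

Lemma encodes_along (a0 a1 a2 : F -> F) T U : flag_system a1 a2 a0 ->
  tree_cotree a0 a1 a2 T U -> contour a1 a2 a0 T x0 = c -> #|~: (T :|: U)| <= 4 * h ->
  exists2 k, k \in codes & encodes a0 a1 a2 k.
Proof.
move=> fs tcTU contour_c outside_h.
have closed_outside := edge_closed_outside fs tcTU.
have [R [subR cardR coverR]] := edge_representatives fs closed_outside.
exists (T, U, R, openers a1 a2 a0 T x0, openers a1 a0 a2 U x0,
        [ffun u => if u \in R then a0 u else x0]); last first.
  by split=> // u uR; rewrite ffunE uR.
rewrite inE outside_h -(leq_pmul2r (_ : 0 < 4)) // -cardR mulnC outside_h /=.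
apply/pffun_onP; split.
  by apply/subsetP => u; rewrite inE ffunE; case: ifP => //; rewrite eqxx.
move=> _ /imageP[u uR ->]; rewrite ffunE uR.
have /(edge_closedP fs)/(_ u)[_ ->] := closed_outside.
exact: (subsetP subR).
Qed.

End Code.

(** * Counting maps *)

Section Orbits.
Variable F : finType.
Implicit Types (A : {set {perm F}}) (e : rel F).

Lemma orbit_gen_connect A e x y :
  (forall a z, a \in A -> connect e z (a z)) -> y \in orbit 'P <<A>> x -> connect e x y.
Proof.
move=> eA /orbitP[g gA <-] /=.
pose G := [set g : {perm F} | [forall z, connect e z (g z)]].
have groupG : group_set G.
  apply/group_setP; split; first by rewrite inE; apply/forallP => z; rewrite perm1.
  move=> a b; rewrite !inE => /forallP ea /forallP eb; apply/forallP => z.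
  by rewrite permM (connect_trans (ea z)).
have /subsetP/(_ g gA) : <<A>>%g \subset Group groupG.
  by rewrite gen_subG; apply/subsetP => a aA; rewrite inE; apply/forallP => z; apply: eA.
by rewrite inE => /forallP/(_ x).
Qed.

Lemma orbit_gen2 (a b : {perm F}) x :
  orbit 'P <<[set a; b]>> x = [set y | connect (alt_step a b) x y].
Proof.
apply/setP => y; rewrite inE; apply/idP/idP.
  apply: orbit_gen_connect => c z; rewrite !inE => /orP[] /eqP->.
    exact: connect_alt_p.
  exact: connect_alt_b.
have orbit_step c z : c \in [set a; b] -> z \in orbit 'P <<[set a; b]>> x ->
    c z \in orbit 'P <<[set a; b]>> x.
  by move=> c_ab; apply: orbit_trans; apply/orbitP; exists c => //; apply: mem_gen.
move=> xy; apply: (connect_ind (P := mem (orbit _ _ x))) xy (orbit_refl _ _ _) => u v.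
by case/orP=> /eqP->; apply: orbit_step; rewrite !inE eqxx ?orbT.
Qed.

Lemma card_orbits_gen2 (a b c : {perm F}) : free_involution a -> free_involution b ->
  #|[set orbit 'P <<[set a; b]>> x | x : F]| = n_comp (subgraph_step a b c set0) F.
Proof.
move=> a_inv b_inv.
rewrite -(eq_n_comp (e := alt_step a b)) -?card_components; last 2 first.
- exact: connect_alt_sym.
- by apply: eq_connect => x y; rewrite /alt_step /subgraph_step /= inE orbF.
by congr #|pred_of_set _|; apply: eq_imset => x; rewrite orbit_gen2.
Qed.

End Orbits.

Section Map.
Variables (m : nat) (t : triple m).
Hypothesis map_t : is_map t.
Notation F := 'I_(4 * m).
Notation a0 := (al0 t).
Notation a1 := (al1 t).
Notation a2 := (al2 t).

Lemma fpf_involution_free (a : {perm F}) : fpf_involution a -> free_involution a.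
Proof.
by case/andP=> /eqP aa /forallP a_neq; split=> // x; rewrite -permM aa perm1.
Qed.

Lemma map_flag_system : flag_system a1 a2 a0.
Proof.
case/and5P: map_t => /fpf_involution_free a0_inv /fpf_involution_free a1_inv.
move=> /fpf_involution_free a2_inv /eqP a02 /andP[/forallP a02_neq _].
have a20 x : a2 (a0 x) = a0 (a2 x) by rewrite -!permM a02.
by split=> // x; rewrite a20.
Qed.

Let fs := map_flag_system.

Lemma map_connected x y : connect (subgraph_step a1 a2 a0 setT) x y.
Proof.
case/and5P: map_t => _ _ _ _ /andP[_ /atransP/(_ x)]; rewrite inE => /(_ isT) orbit_x.
apply: (@orbit_gen_connect _ [set a0; a1; a2]); last by rewrite orbit_x inE.
move=> a z; rewrite !inE -orbA => /or3P[] /eqP->.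
- by apply: joined_r; rewrite inE.
- exact: joined_p.
- exact: joined_q.
Qed.

Lemma nverts_components : nverts t = n_comp (subgraph_step a1 a2 a0 set0) F.
Proof. exact: card_orbits_gen2 (flag_p fs) (flag_q fs). Qed.

Lemma nfaces_components : nfaces t = n_comp (subgraph_step a1 a0 a2 set0) F.
Proof.
by rewrite -(card_orbits_gen2 _ (flag_p fs) (flag_r fs)) /nfaces /face_of setUC.
Qed.

Lemma edge_of_sub x : edge_of t x \subset edge a2 a0 x.
Proof.
apply/subsetP => y; rewrite /edge_of orbit_gen2 inE => xy.
apply: (connect_ind (P := mem (edge a2 a0 x))) xy (edge_id _ _ x) => u v uv /= ux.
have /(edge_closedP fs)/(_ u)[a2u a0u] := edge_closed_edge fs x.
by case/orP: uv => /eqP->; rewrite ?a2u ?a0u.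
Qed.

Lemma leq_nedges : m <= nedges t.
Proof.
suff : 4 * m <= nedges t * 4 by lia.
rewrite -[leqLHS]card_ord -cardsT.
have -> : [set: F] = cover [set edge_of t x | x : F].
  apply/setP => x; rewrite inE; apply/esym/bigcupP.
  by exists (edge_of t x); [apply: imset_f | apply: orbit_refl].
apply: leq_trans (leq_card_cover _) _; rewrite -sum_nat_const.
apply: leq_sum => _ /imsetP[x _ ->]; apply: leq_trans (subset_leq_card (edge_of_sub x)) _.
by rewrite (card_edge fs).
Qed.

Lemma map_euler_genus_le h : has_euler_genus t h -> euler_genus_le a0 a1 a2 h.
Proof.
rewrite /euler_genus_le card_ord -nverts_components -nfaces_components => /eqP.
by have := leq_nedges; lia.
Qed.

Lemma vertex_of_al1 x : vertex_of t (a1 x) = vertex_of t x.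
Proof. by apply/orbit_eqP/orbitP; exists a1 => //; apply/mem_gen/set21. Qed.

Lemma vertex_of_al2 x : vertex_of t (a2 x) = vertex_of t x.
Proof. by apply/orbit_eqP/orbitP; exists a2 => //; apply/mem_gen/set22. Qed.

Lemma leq1_al1_closed_edge x : (forall y, y \in edge a2 a0 x -> a1 y \in edge a2 a0 x) ->
  m <= 1.
Proof.
move=> closed1; suff full y : y \in edge a2 a0 x.
  have : #|[set: F]| <= #|edge a2 a0 x| by apply/subset_leq_card/subsetP.
  by rewrite cardsT card_ord (card_edge fs); lia.
have xy := map_connected x y.
apply: (connect_ind (P := mem (edge a2 a0 x))) xy (edge_id _ _ x) => u v uv ux.
have /(edge_closedP fs)/(_ u)[a2u a0u] := edge_closed_edge fs x.
by case/or3P: uv => [||/andP[_]] /eqP-> /=; rewrite ?a2u ?a0u // closed1.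
Qed.

Hypothesis simple_t : simple_map t.

Lemma vertex_of_al0_neq x : vertex_of t (a0 x) != vertex_of t x.
Proof. by rewrite eq_sym; case/andP: simple_t => /forallP. Qed.

Lemma al0_neq_al1 x : a0 x != a1 x.
Proof. by apply: contra (vertex_of_al0_neq x) => /eqP->; rewrite vertex_of_al1. Qed.

Lemma al1_mem_edge x : a1 x \in edge a2 a0 x -> a1 x = a2 x.
Proof.
have a1_neq := (flag_p fs).2 x; rewrite !inE (negPf a1_neq).
rewrite [a1 x == a0 x]eq_sym (negPf (al0_neq_al1 x)) /= orbF.
case/orP=> /eqP // a1x; have := vertex_of_al0_neq x.
by rewrite -vertex_of_al2 -a1x vertex_of_al1 eqxx.
Qed.

(* A face of degree two would make the edges of [x] and [a1 x] parallel. *)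
Lemma al1_al0_neq x : 1 < m -> a1 (a0 x) != a0 (a1 x).
Proof.
move=> m_gt1; apply/negP => /eqP a10x.
have a1x : a1 x = a2 x.
  apply/al1_mem_edge/(subsetP (edge_of_sub x)).
  case/andP: simple_t => _ /forallP/(_ x)/forallP/(_ (a1 x))/implyP.
  rewrite vertex_of_al1 -a10x vertex_of_al1 => /(_ (eqxx _)) /eqP->.
  exact: orbit_refl.
have a1a0x : a1 (a0 x) = a2 (a0 x) by rewrite a10x a1x (flag_comm fs).
have a1K := (flag_p fs).1.
have a12x : a1 (a2 x) = x by rewrite -a1x a1K.
have a120x : a1 (a2 (a0 x)) = a0 x by rewrite -a1a0x a1K.
suff /leq1_al1_closed_edge : forall y, y \in edge a2 a0 x -> a1 y \in edge a2 a0 x by lia.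
by move=> y; rewrite !inE -!orbA => /or4P[] /eqP->;
  rewrite ?a12x ?a120x ?a1x ?a1a0x ?eqxx ?orbT.
Qed.

Lemma card_face_gt4 x : 1 < m -> 4 < #|face_of t x|.
Proof.
move=> m_gt1; have [[a0K a0_neq] [a1K a1_neq]] := (flag_r fs, flag_p fs).
have face0 y : y \in face_of t x -> a0 y \in face_of t x.
  by apply: orbit_trans; apply/orbitP; exists a0 => //; apply/mem_gen/set21.
have face1 y : y \in face_of t x -> a1 y \in face_of t x.
  by apply: orbit_trans; apply/orbitP; exists a1 => //; apply/mem_gen/set22.
have face_x : x \in face_of t x by apply: orbit_refl.
pose s := [:: x; a0 x; a1 x; a1 (a0 x); a0 (a1 x)].
have uniq_s : uniq s.
  have a10_neq : a1 (a0 x) != x by rewrite (inv_eq a1K) al0_neq_al1.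
  have a01_neq : a0 (a1 x) != x by rewrite (inv_eq a0K) eq_sym al0_neq_al1.
  rewrite /= !inE !negb_or !andbT !(eq_sym x) a0_neq a1_neq a10_neq a01_neq al0_neq_al1.
  rewrite (eq_sym (a0 x)) a1_neq (inj_eq perm_inj) (eq_sym x) a1_neq.
  rewrite (inj_eq perm_inj) (eq_sym x) a0_neq (eq_sym (a1 x)) a0_neq.
  exact: al1_al0_neq.
rewrite cardE; apply: (@leq_trans (size s)) => //.
apply: uniq_leq_size => // y; rewrite mem_enum !inE.
by case/or4P=> [|||/orP[]] /eqP->; rewrite ?(face0, face1).
Qed.

Lemma leq_nfaces : 1 < m -> nfaces t * 5 <= 4 * m.
Proof.
move=> m_gt1; rewrite -[leqRHS]card_ord -cardsT.
have partF : partition [set face_of t x | x : F] setT.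
  have <- : [set face_of t x | x in [set: F]] = [set face_of t x | x : F].
    by apply/setP => C; apply/imsetP/imsetP => -[x _ ->]; exists x; rewrite ?inE.
  by apply: orbit_partition; apply/actsP => a _ x; rewrite !inE.
rewrite (card_partition partF) -sum_nat_const.
by apply: leq_sum => _ /imsetP[x _ ->]; apply: card_face_gt4.
Qed.

End Map.

Lemma iso_classes_eq0 m n h o : 0 < n -> 5 * (n + h) < m -> iso_classes m n h o = set0.
Proof.
move=> n_gt0; apply: contraTeq; rewrite imset_eq0 -leqNgt => /set0Pn[t].
rewrite inE => /and5P[map_t simple_t /eqP nt /eqP genus_t _].
have := leq_nedges map_t; have [|m_gt1] := leqP m 1; first by lia.
by have := leq_nfaces map_t simple_t m_gt1; lia.
Qed.

Lemma map_iso_class m (t u : triple m) :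
  map_iso t u -> [set v | map_iso t v] = [set v | map_iso u v].
Proof.
case/existsP=> s /eqP->; apply: eq_finset => v.
apply/existsP/existsP => -[g /eqP->].
  by exists (s^-1 * g)%g; rewrite /al0 /al1 /al2 /= -!conjgM mulKVg.
by exists (s * g)%g; rewrite /al0 /al1 /al2 /= !conjgM.
Qed.

Lemma map_iso_conj m (t u : triple m) (s s' : {perm 'I_(4 * m)}) :
  (al0 t ^ s =1 al0 u ^ s')%g -> (al1 t ^ s =1 al1 u ^ s')%g ->
  (al2 t ^ s =1 al2 u ^ s')%g -> map_iso t u.
Proof.
case: t u => [[t0 t1] t2] [[u0 u1] u2] /= /permP e0 /permP e1 /permP e2.
apply/existsP; exists (s * s'^-1)%g.
by rewrite /al0 /al1 /al2 /= !conjgM e0 e1 e2 !conjgK.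
Qed.

Definition encodes_map m (x0 : 'I_(4 * m)) c (t : triple m) k :=
  exists s : {perm 'I_(4 * m)},
    encodes x0 c (al0 t ^ s)%g (al1 t ^ s)%g (al2 t ^ s)%g k.

Lemma map_encodable m (x0 : 'I_(4 * m)) c h (t : triple m) :
  is_map t -> has_euler_genus t h ->
  uniq c -> size c = #|'I_(4 * m)| -> head x0 c = x0 ->
  exists2 k, k \in codes x0 h & encodes_map x0 c t k.
Proof.
move=> map_t genus_t uniq_c size_c head_c; have fs := map_flag_system map_t.
have genus_h := map_euler_genus_le map_t genus_t.
have [s [T [U [tcTU contour_c outside_h]]]] :=
  tree_cotree_along fs (map_connected map_t) genus_h uniq_c size_c head_c.
have [k k_code t_k] := encodes_along (flag_system_conj s fs) tcTU contour_c outside_h.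
by exists k; last exists s.
Qed.

Lemma encodes_map_iso m (x0 : 'I_(4 * m)) c (t u : triple m) k :
  is_map t -> is_map u -> encodes_map x0 c t k -> encodes_map x0 c u k -> map_iso t u.
Proof.
move=> map_t map_u [s t_k] [s' u_k].
have fs_t := flag_system_conj s (map_flag_system map_t).
have fs_u := flag_system_conj s' (map_flag_system map_u).
by have [] := encodes_inj fs_t fs_u t_k u_k; apply: map_iso_conj.
Qed.

Lemma card_iso_classes m n h o : 0 < n ->
  #|iso_classes m n h o| <= 2 ^ (5 * (4 * m)) * (4 * h) ^ h.
Proof.
move=> n_gt0; rewrite /iso_classes.
have [->|/set0Pn[t0]] := eqVneq (simple_maps_in m n h o) set0.
  by rewrite imset0 cards0.
rewrite inE => /and5P[_ _ /eqP nt0 _ _].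
have [x _] : exists x, x \in 'I_(4 * m).
  by move: n_gt0; rewrite -nt0 => /card_gt0P[_ /imsetP[x _ _]]; exists x.
pose c := enum 'I_(4 * m); pose x0 := head x c.
rewrite -[4 * m in leqRHS]card_ord; apply: leq_trans (card_codes x0 h).
apply: (leq_card_imset_encoding (encodes := encodes_map x0 c)) => [t|t u].
  rewrite inE => /and5P[map_t _ _ genus_t _]; apply: map_encodable => //.
  - exact: enum_uniq.
  - by rewrite -cardE.
  - by rewrite /x0; case: (c).
rewrite !inE => /andP[map_t _] /andP[map_u _] k t_k u_k.
exact: map_iso_class (encodes_map_iso map_t map_u t_k u_k).
Qed.

Theorem theorem7 :
  exists c n0 : nat, forall (n h : nat) (o : bool),
    n0 <= n -> surface_exists h o ->
    num_simple_maps n h o <= c ^ (n + h) * h ^ h.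
Proof.
exists (2 ^ 107), 1 => n h o n_gt0 _; set L := 5 * (n + h).
apply: leq_trans (_ : L.+1 * (2 ^ (20 * L) * (4 * h) ^ h) <= _).
  apply: (@leq_sum_truncated (fun m => #|iso_classes m n h o|)) => m.
  have [mL|Lm] := leqP m L; last by rewrite iso_classes_eq0 ?cards0.
  rewrite mul1n (leq_trans (card_iso_classes _ _ _ n_gt0)) // leq_mul2r leq_exp2l //.
  by apply/orP; right; lia.
apply: leq_trans (_ : 2 ^ L * (2 ^ (20 * L) * (2 ^ (2 * h) * h ^ h)) <= _).
  by rewrite expnMn -[4]/(2 ^ 2) -expnM leq_mul // ltn_expl.
rewrite !mulnA -!expnD -expnM leq_mul2r leq_exp2l //; apply/orP; right; rewrite /L; lia.
Qed.
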